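(* Let $ABC$ be a nondegenerate triangle with side lengths $a,b,c$, circumradius $R$, and inradius $r$, and let $k$ be a real number. Write $$ L_k=\left(\frac{a(b+c-a)}{bc}\right)^k+\left(\frac{b(c+a-b)}{ca}\right)^k+\left(\frac{c(a+b-c)}{ab}\right)^k . $$ If $k>1$, then $$ L_k\ \ge\ 2+\left(\frac{2r}{R}\right)^k . $$ If $k<1$, then $$ L_k\ \le\ 2+\left(\frac{2r}{R}\right)^k . $$ For $k\neq 0,1$, equality $L_k=2+\left(\frac{2r}{R}\right)^k$ holds if and only if $ABC$ is isosceles. For $k=0$ and for $k=1$, equality $L_k=2+\left(\frac{2r}{R}\right)^k$ holds for every nondegenerate triangle $ABC$.
   Context: A triangle is isosceles if at least two of its sides have equal length (equilateral triangles are included). Powers are real powers of positive real numbers; each base $\frac{a(b+c-a)}{bc}$ etc. is positive because the triangle is nondegenerate. *)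

(* Defs.v *)
From Stdlib Require Import Reals.
Open Scope R_scope.

Definition point : Type := (R * R)%type.

Definition pdist (P Q : point) : R := dist_euc (fst P) (snd P) (fst Q) (snd Q).

(* The line through P and Q when P <> Q; the single point P when P = Q. *)
Definition on_line (P Q X : point) : Prop :=
  exists t : R,
    X = (fst P + t * (fst Q - fst P), snd P + t * (snd Q - snd P)).

Definition collinear (A B C : point) : Prop :=
  exists P Q : point, on_line P Q A /\ on_line P Q B /\ on_line P Q C.

Definition nondegenerate (A B C : point) : Prop := ~ collinear A B C.

Definition isosceles (A B C : point) : Prop :=
  pdist A B = pdist B C \/ pdist B C = pdist C A \/ pdist C A = pdist A B.

Definition is_circumradius (A B C : point) (rho : R) : Prop :=
  exists O : point, pdist O A = rho /\ pdist O B = rho /\ pdist O C = rho.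

Definition in_interior (A B C X : point) : Prop :=
  exists u v w : R,
    0 < u /\ 0 < v /\ 0 < w /\ u + v + w = 1 /\
    X = (u * fst A + v * fst B + w * fst C, u * snd A + v * snd B + w * snd C).

(* For rho > 0: the circle with centre O and radius rho meets the line PQ in
   exactly one point. *)
Definition tangent_to_line (O : point) (rho : R) (P Q : point) : Prop :=
  exists! T : point, on_line P Q T /\ pdist O T = rho.

(* Requiring the centre to be interior excludes the three excircles. *)
Definition is_inradius (A B C : point) (rho : R) : Prop :=
  0 < rho /\
  exists I : point,
    in_interior A B C I /\
    tangent_to_line I rho B C /\
    tangent_to_line I rho C A /\
    tangent_to_line I rho A B.

(* Rpower x k = exp (k * ln x) is the real power only for x > 0; for a
   nondegenerate triangle the three bases below are positive. *)
Definition Lsum (a b c k : R) : R :=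
  Rpower (a * (b + c - a) / (b * c)) k +
  Rpower (b * (c + a - b) / (c * a)) k +
  Rpower (c * (a + b - c) / (a * b)) k.

(* Main.v *)
(** Let [x, y, z] be the three bases and [p = x y z]. Then [p = 2 r / R],
    [x + y + z = 2 + p], and [1 - y z = ((b - c) / a) ^ 2] (and cyclically).
    If two sides agree, then two of [x, y, z] are [1] and the third is [p].
    For a scalene triangle [p] is smaller than each of [x, y, z]. Put
    [F k = x^k + y^k + z^k - 2 - p^k]. Then [F 0 = F' 0 = F 1 = 0], and
    [F'' k * p^(-k)] is strictly increasing, so [F''] changes sign at most
    once, from negative to positive; the mean value theorem then forces
    [F < 0] on [(-oo, 0)] and [(0, 1)], and [F > 0] on [(1, +oo)]. *)

Require Import Defs.
From Stdlib Require Import Reals.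
From Stdlib Require Import Lra Psatz.
From Coquelicot Require Import Coquelicot.
Open Scope R_scope.

(** * Sign of a function from a single sign change of its second derivative *)

Section SignOfConcaveConvex.

Variables F F1 F2 : R -> R.
Hypothesis F_deriv : forall t, derivable_pt_lim F t (F1 t).
Hypothesis F1_deriv : forall t, derivable_pt_lim F1 t (F2 t).
Hypothesis F2_sign : forall s t, s < t -> 0 <= F2 s -> 0 < F2 t.
Hypotheses (F_0 : F 0 = 0) (F1_0 : F1 0 = 0) (F_1 : F 1 = 0).

(** Since [F1] vanishes at 0, the mean value theorem finds a point between 0 and [s] where [F2] is
    nonnegative. At every later point [F2] is positive, so [F1] grows beyond [s]. *)
Lemma F1_pos_after (s t : R) : 0 < s -> 0 <= F1 s -> s < t -> 0 < F1 t.
Proof.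
intros Hs H1 Hst.
destruct (MVT_cor2 F1 F2 0 s Hs (fun c _ => F1_deriv c)) as [e [He Hes]].
destruct (MVT_cor2 F1 F2 s t Hst (fun c _ => F1_deriv c)) as [e' [He' Hes']].
assert (H2 : 0 <= F2 e) by nra.
assert (H2' : 0 < F2 e') by (apply (F2_sign e); lra).
nra.
Qed.

Lemma F_increasing_after (s t : R) : 0 < s -> 0 <= F s -> s < t -> F s < F t.
Proof.
intros Hs H0 Hst.
destruct (MVT_cor2 F F1 0 s Hs (fun c _ => F_deriv c)) as [e [He Hes]].
destruct (MVT_cor2 F F1 s t Hst (fun c _ => F_deriv c)) as [e' [He' Hes']].
assert (H1 : 0 <= F1 e) by nra.
assert (H1' : 0 < F1 e') by (apply (F1_pos_after e); lra).
nra.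
Qed.

Lemma F_pos_above_1 (k : R) : 1 < k -> 0 < F k.
Proof.
intros Hk; rewrite <- F_1; apply F_increasing_after; lra.
Qed.

(** If [F k] were nonnegative, growth after [k] would make [F 1] positive. *)
Lemma F_neg_between_0_1 (k : R) : 0 < k -> k < 1 -> F k < 0.
Proof.
intros Hk Hk1; destruct (Rlt_le_dec (F k) 0) as [H|H]; [exact H|].
pose proof (F_increasing_after k 1 Hk H Hk1); lra.
Qed.

(** Rolle on [0, 1] and then on [0, e] gives a zero [z > 0] of [F2]. Hence [F2] is negative left of
    0, so [F1] is positive there and [F] rises to its value 0 at 0. *)
Lemma F_neg_below_0 (k : R) : k < 0 -> F k < 0.
Proof.
intros Hk.
destruct (MVT_cor2 F F1 0 1 Rlt_0_1 (fun c _ => F_deriv c)) as [e [He Hes]].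
assert (He0 : 0 < e) by lra.
destruct (MVT_cor2 F1 F2 0 e He0 (fun c _ => F1_deriv c)) as [z [Hz Hze]].
destruct (MVT_cor2 F F1 k 0 Hk (fun c _ => F_deriv c)) as [g [Hg Hgk]].
assert (Hg0 : g < 0) by lra.
destruct (MVT_cor2 F1 F2 g 0 Hg0 (fun c _ => F1_deriv c)) as [h [Hh Hhg]].
assert (F2z : F2 z <= 0) by nra.
assert (F2h : F2 h < 0).
{ destruct (Rlt_le_dec (F2 h) 0) as [H|H]; [exact H|].
  assert (Hlt : h < z) by lra.
  pose proof (F2_sign h z Hlt H); lra. }
assert (0 < F1 g) by nra.
nra.
Qed.

End SignOfConcaveConvex.

(** * Exponential sums and real powers *)

Lemma weighted_exp_le (u q s t : R) :
  q < u -> s < t -> u * u * exp (s * (u - q)) <= u * u * exp (t * (u - q)).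
Proof.
intros Hq Hst; apply Rmult_le_compat_l; [nra|].
left; apply exp_increasing; nra.
Qed.

Lemma weighted_exp_lt (u q s t : R) :
  u <> 0 -> q < u -> s < t ->
  u * u * exp (s * (u - q)) < u * u * exp (t * (u - q)).
Proof.
intros Hu Hq Hst; apply Rmult_lt_compat_l; [nra|].
apply exp_increasing; nra.
Qed.

Section ExponentialSum.

Variables u v w : R.
Hypotheses (Huv : u + v < 0) (Hvw : v + w < 0) (Hwu : w + u < 0).

Let q := u + v + w.
Let F k := exp (k * u) + exp (k * v) + exp (k * w) - 2 - exp (k * q).
Let F1 k :=
  u * exp (k * u) + v * exp (k * v) + w * exp (k * w) - q * exp (k * q).
Let F2 k :=
  u * u * exp (k * u) + v * v * exp (k * v) + w * w * exp (k * w)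
  - q * q * exp (k * q).

Lemma expsum_deriv (t : R) : derivable_pt_lim F t (F1 t).
Proof.
apply is_derive_Reals; unfold F, F1; auto_derive; [exact I|ring].
Qed.

Lemma expsum_deriv1 (t : R) : derivable_pt_lim F1 t (F2 t).
Proof.
apply is_derive_Reals; unfold F1, F2; auto_derive; [exact I|ring].
Qed.

(** The differences [u - q], [v - q], [w - q] are the negated pairwise sums, hence positive; so the
    bracket increases with [t] and carries the sign of [F2]. *)
Lemma expsum_deriv2_factor (t : R) :
  F2 t = exp (t * q) * (u * u * exp (t * (u - q)) + v * v * exp (t * (v - q))
                        + w * w * exp (t * (w - q)) - q * q).
Proof.
assert (E : forall e, exp (t * e) = exp (t * q) * exp (t * (e - q))).
{ intros e; rewrite <- exp_plus; f_equal; ring. }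
unfold F2; rewrite (E u), (E v), (E w); ring.
Qed.

Lemma expsum_deriv2_sign (s t : R) : s < t -> 0 <= F2 s -> 0 < F2 t.
Proof.
intros Hst; rewrite !expsum_deriv2_factor; intros Hs.
pose proof (exp_pos (s * q)); pose proof (exp_pos (t * q)).
assert (Hqu : q < u) by (unfold q; lra).
assert (Hqv : q < v) by (unfold q; lra).
assert (Hqw : q < w) by (unfold q; lra).
pose proof (weighted_exp_le u q s t Hqu Hst).
pose proof (weighted_exp_le v q s t Hqv Hst).
pose proof (weighted_exp_le w q s t Hqw Hst).
apply Rmult_lt_0_compat; [assumption|].
(* As [u + v < 0], the weights of [u] and [v] cannot both vanish, so at least one term grows
   strictly. *)
destruct (Req_dec u 0) as [Hu|Hu].
- assert (Hv : v <> 0) by lra.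
  pose proof (weighted_exp_lt v q s t Hv Hqv Hst); nra.
- pose proof (weighted_exp_lt u q s t Hu Hqu Hst); nra.
Qed.

Hypothesis Hsum : exp u + exp v + exp w = 2 + exp q.

Lemma expsum_signs (k : R) :
  (k > 1 -> exp (k * u) + exp (k * v) + exp (k * w) > 2 + exp (k * q)) /\
  (k < 1 -> k <> 0 ->
   exp (k * u) + exp (k * v) + exp (k * w) < 2 + exp (k * q)).
Proof.
assert (F0 : F 0 = 0) by (unfold F; rewrite !Rmult_0_l, exp_0; ring).
assert (F10 : F1 0 = 0) by (unfold F1, q; rewrite !Rmult_0_l, exp_0; ring).
assert (F11 : F 1 = 0) by (unfold F; rewrite !Rmult_1_l; lra).
split; [intros Hk|intros Hk Hk0].
- pose proof (F_pos_above_1 F F1 F2 expsum_deriv expsum_deriv1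
                expsum_deriv2_sign F0 F10 F11 k Hk) as H.
  unfold F in H; lra.
- assert (H : F k < 0); [|unfold F in H; lra].
  destruct (Rlt_le_dec k 0) as [Hn|Hn].
  + exact (F_neg_below_0 F F1 F2 expsum_deriv expsum_deriv1
             expsum_deriv2_sign F0 F10 F11 k Hn).
  + apply (F_neg_between_0_1 F F1 F2 expsum_deriv expsum_deriv1
             expsum_deriv2_sign F0 F10 F11 k); lra.
Qed.

End ExponentialSum.

(** Under logarithms, pairwise products below 1 become negative pairwise sums, and the relation on
    [x + y + z] becomes the zero of [F] at 1. *)
Lemma Rpower_sum_signs (x y z k : R) :
  0 < x -> 0 < y -> 0 < z -> x * y < 1 -> y * z < 1 -> z * x < 1 ->
  x + y + z = 2 + x * y * z ->
  (k > 1 -> Rpower x k + Rpower y k + Rpower z k > 2 + Rpower (x * y * z) k) /\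
  (k < 1 -> k <> 0 ->
   Rpower x k + Rpower y k + Rpower z k < 2 + Rpower (x * y * z) k).
Proof.
intros Hx Hy Hz Hxy Hyz Hzx Hsum.
assert (L : forall s t, 0 < s -> 0 < t -> s * t < 1 -> ln s + ln t < 0).
{ intros s t Hs Ht Hst; rewrite <- ln_mult, <- ln_1 by assumption.
  apply ln_increasing; [nra|assumption]. }
assert (Hp : 0 < x * y) by nra.
unfold Rpower; rewrite !ln_mult by assumption.
apply expsum_signs; try (apply L; assumption).
rewrite !exp_plus, !exp_ln by assumption; assumption.
Qed.

(** * Area, circumradius and inradius in coordinates *)

(** Twice the signed area of the triangle. *)
Definition area2 (A B C : point) : R :=
  (fst B - fst A) * (snd C - snd A) - (snd B - snd A) * (fst C - fst A).

Lemma pdist_nonneg (P Q : point) : 0 <= pdist P Q.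
Proof. apply sqrt_pos. Qed.

Lemma pdist_sqr (P Q : point) :
  pdist P Q * pdist P Q =
  (fst P - fst Q) * (fst P - fst Q) + (snd P - snd Q) * (snd P - snd Q).
Proof.
unfold pdist, dist_euc; rewrite sqrt_sqrt by
  (apply Rplus_le_le_0_compat; apply Rle_0_sqr).
reflexivity.
Qed.

Lemma pdist_sqr_eq (P Q : point) (d : R) :
  d = pdist P Q ->
  d * d =
  (fst P - fst Q) * (fst P - fst Q) + (snd P - snd Q) * (snd P - snd Q).
Proof. intros ->; apply pdist_sqr. Qed.

Lemma pdist_eq (P Q : point) (d : R) :
  0 <= d ->
  d * d =
  (fst P - fst Q) * (fst P - fst Q) + (snd P - snd Q) * (snd P - snd Q) ->
  pdist P Q = d.
Proof.
intros Hd E; rewrite <- pdist_sqr in E.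
apply Rsqr_inj; [apply pdist_nonneg|exact Hd|symmetry; exact E].
Qed.

Lemma nondegenerate_area2 (A B C : point) :
  nondegenerate A B C -> area2 A B C <> 0.
Proof.
destruct A as [a1 a2], B as [b1 b2], C as [c1 c2].
unfold area2; simpl; intros Hnd HW; apply Hnd.
destruct (Req_dec ((b1 - a1) * (b1 - a1) + (b2 - a2) * (b2 - a2)) 0) as [E|E].
- apply Rplus_sqr_eq_0 in E; destruct E as [E1 E2].
  apply Rminus_diag_uniq in E1, E2; subst b1 b2.
  exists (a1, a2), (c1, c2); unfold on_line; simpl.
  split; [exists 0; f_equal; ring|].
  split; [exists 0; f_equal; ring|exists 1; f_equal; ring].
- exists (a1, a2), (b1, b2); unfold on_line; simpl.
  split; [exists 0; f_equal; ring|].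
  split; [exists 1; f_equal; ring|].
  set (n := (b1 - a1) * (b1 - a1) + (b2 - a2) * (b2 - a2)) in E.
  (* Parameter of the orthogonal projection of [C] onto the line [AB]; zero area makes [C] its own
     projection. *)
  exists (((c1 - a1) * (b1 - a1) + (c2 - a2) * (b2 - a2)) / n).
  f_equal; apply (Rmult_eq_reg_l n); try exact E.
  + replace (n * c1) with
      (n * a1 + ((c1 - a1) * (b1 - a1) + (c2 - a2) * (b2 - a2)) * (b1 - a1)
       - (b2 - a2) * ((b1 - a1) * (c2 - a2) - (b2 - a2) * (c1 - a1)))
      by (unfold n; ring).
    rewrite HW; field; exact E.
  + replace (n * c2) with
      (n * a2 + ((c1 - a1) * (b1 - a1) + (c2 - a2) * (b2 - a2)) * (b2 - a2)
       + (b1 - a1) * ((b1 - a1) * (c2 - a2) - (b2 - a2) * (c1 - a1)))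
      by (unfold n; ring).
    rewrite HW; field; exact E.
Qed.

(** The right side is a polynomial in the squared sides, so coordinates can be substituted without
    square roots. *)
Lemma heron (A B C : point) (a b c : R) :
  a = pdist B C -> b = pdist C A -> c = pdist A B ->
  4 * (area2 A B C * area2 A B C) =
  (a + b + c) * ((b + c - a) * (c + a - b) * (a + b - c)).
Proof.
intros ha hb hc.
apply pdist_sqr_eq in ha, hb, hc.
replace ((a + b + c) * ((b + c - a) * (c + a - b) * (a + b - c))) with
  (4 * (b * b) * (c * c) - (b * b + c * c - a * a) * (b * b + c * c - a * a))
  by ring.
rewrite ha, hb, hc; unfold area2; ring.
Qed.

(** The square of the classical [abc = 4RS], with [S] the area; squaring removes the sign of
    [area2]. *)
Lemma circumradius_sqr (A B C : point) (a b c rho : R) :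
  a = pdist B C -> b = pdist C A -> c = pdist A B ->
  is_circumradius A B C rho ->
  4 * (rho * rho) * (area2 A B C * area2 A B C) = (a * a) * (b * b) * (c * c).
Proof.
intros ha hb hc [O [hA [hB hC]]].
symmetry in hA, hB, hC.
apply pdist_sqr_eq in ha, hb, hc, hA, hB, hC.
rewrite ha, hb, hc.
destruct A as [a1 a2], B as [b1 b2], C as [c1 c2], O as [o1 o2].
unfold area2; simpl in *; clear ha hb hc.
set (W := (b1 - a1) * (c2 - a2) - (b2 - a2) * (c1 - a1)).
(* Subtracting the circle equations gives a linear system for the centre,
   solved by Cramer's rule. *)
assert (E1 : 2 * W * (o1 - a1) =
  ((b1 - a1) * (b1 - a1) + (b2 - a2) * (b2 - a2)) * (c2 - a2)
  - ((c1 - a1) * (c1 - a1) + (c2 - a2) * (c2 - a2)) * (b2 - a2)).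
{ replace ((b1 - a1) * (b1 - a1) + (b2 - a2) * (b2 - a2)) with
    (2 * ((o1 - a1) * (b1 - a1) + (o2 - a2) * (b2 - a2))) by lra.
  replace ((c1 - a1) * (c1 - a1) + (c2 - a2) * (c2 - a2)) with
    (2 * ((o1 - a1) * (c1 - a1) + (o2 - a2) * (c2 - a2))) by lra.
  unfold W; ring. }
assert (E2 : 2 * W * (o2 - a2) =
  ((c1 - a1) * (c1 - a1) + (c2 - a2) * (c2 - a2)) * (b1 - a1)
  - ((b1 - a1) * (b1 - a1) + (b2 - a2) * (b2 - a2)) * (c1 - a1)).
{ replace ((b1 - a1) * (b1 - a1) + (b2 - a2) * (b2 - a2)) with
    (2 * ((o1 - a1) * (b1 - a1) + (o2 - a2) * (b2 - a2))) by lra.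
  replace ((c1 - a1) * (c1 - a1) + (c2 - a2) * (c2 - a2)) with
    (2 * ((o1 - a1) * (c1 - a1) + (o2 - a2) * (c2 - a2))) by lra.
  unfold W; ring. }
rewrite hA.
transitivity ((2 * W * (o1 - a1)) * (2 * W * (o1 - a1))
              + (2 * W * (o2 - a2)) * (2 * W * (o2 - a2))); [ring|].
rewrite E1, E2; ring.
Qed.

(* The reflection of the contact point in the foot of the perpendicular from
   the centre is also at distance [rho], so the contact point is that foot. *)
Lemma tangent_area2 (O P Q : point) (rho : R) :
  0 <= rho -> tangent_to_line O rho P Q ->
  area2 O P Q * area2 O P Q = (rho * rho) * (pdist P Q * pdist P Q).
Proof.
intros Hrho [T [[[t HT] hT] Huniq]].
symmetry in hT; apply pdist_sqr_eq in hT.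
rewrite pdist_sqr, hT.
destruct P as [p1 p2], Q as [q1 q2], O as [o1 o2].
unfold area2; subst T; simpl in *.
set (d1 := q1 - p1) in *; set (d2 := q2 - p2) in *.
assert (Q1 : q1 = p1 + d1) by (unfold d1; ring).
assert (Q2 : q2 = p2 + d2) by (unfold d2; ring).
clearbody d1 d2; subst q1 q2.
destruct (Req_dec (d1 * d1 + d2 * d2) 0) as [E|E].
{ apply Rplus_sqr_eq_0 in E; destruct E as [-> ->]; ring. }
(* Parameter of the foot of the perpendicular from [O]. *)
set (t0 := ((o1 - p1) * d1 + (o2 - p2) * d2) / (d1 * d1 + d2 * d2)).
assert (Ht0 : t0 * (d1 * d1 + d2 * d2) = (o1 - p1) * d1 + (o2 - p2) * d2)
  by (unfold t0; field; exact E).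
clearbody t0.
assert (HT' : (p1 + t * d1, p2 + t * d2) =
              (p1 + (2 * t0 - t) * d1, p2 + (2 * t0 - t) * d2)).
{ apply Huniq; split; [exists (2 * t0 - t); simpl; f_equal; ring|].
  apply pdist_eq; [exact Hrho|]; simpl; rewrite hT.
  assert (X : 4 * (t - t0) * ((o1 - p1) * d1 + (o2 - p2) * d2) =
              4 * (t - t0) * (t0 * (d1 * d1 + d2 * d2))) by (rewrite Ht0; ring).
  lra. }
injection HT' as X1 X2.
assert (t = t0).
{ assert (Y1 : (t - t0) * d1 = 0) by lra.
  assert (Y2 : (t - t0) * d2 = 0) by lra.
  assert (Z : (t - t0) * (d1 * d1 + d2 * d2) = 0)
    by (transitivity ((t - t0) * d1 * d1 + (t - t0) * d2 * d2);
        [ring|rewrite Y1, Y2; ring]).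
  apply Rmult_integral in Z; destruct Z; [lra|contradiction]. }
subst t0.
assert (Z : (o1 - (p1 + t * d1)) * d1 + (o2 - (p2 + t * d2)) * d2 = 0) by lra.
apply Rminus_diag_uniq.
(* Lagrange's identity: squared cross product plus squared dot product equals the product of squared
   lengths, and here the dot product vanishes. *)
transitivity (- (((o1 - (p1 + t * d1)) * d1 + (o2 - (p2 + t * d2)) * d2) *
                 ((o1 - (p1 + t * d1)) * d1 + (o2 - (p2 + t * d2)) * d2)));
  [ring|rewrite Z; ring].
Qed.

Lemma sqr_scaled_abs (u W d : R) :
  0 <= u -> 0 <= d -> (u * W) * (u * W) = d * d -> u * Rabs W = d.
Proof.
intros Hu Hd E.
rewrite <- (Rabs_pos_eq u Hu), <- Rabs_mult, <- (Rabs_pos_eq d Hd).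
apply Rsqr_eq_abs_0; exact E.
Qed.

(** The barycentric weights of the incentre are the area fractions of [IBC], [ICA], [IAB]; by
    tangency each of these triangles has height [r] over a side, and the three areas add up. *)
Lemma inradius_area2 (A B C : point) (a b c r : R) :
  a = pdist B C -> b = pdist C A -> c = pdist A B ->
  is_inradius A B C r -> Rabs (area2 A B C) = r * (a + b + c).
Proof.
intros ha hb hc [Hr [I [[u [v [w [Hu [Hv [Hw [Huvw HI]]]]]]] [tA [tB tC]]]]].
apply tangent_area2 in tA, tB, tC; try lra.
rewrite <- ha in tA; rewrite <- hb in tB; rewrite <- hc in tC.
assert (Ha : 0 <= a) by (rewrite ha; apply pdist_nonneg).
assert (Hb : 0 <= b) by (rewrite hb; apply pdist_nonneg).
assert (Hc : 0 <= c) by (rewrite hc; apply pdist_nonneg).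
assert (w = 1 - u - v) by lra; subst w.
assert (IA : area2 I B C = u * area2 A B C)
  by (subst I; unfold area2; simpl; ring).
assert (IB : area2 I C A = v * area2 A B C)
  by (subst I; unfold area2; simpl; ring).
assert (IC : area2 I A B = (1 - u - v) * area2 A B C)
  by (subst I; unfold area2; simpl; ring).
rewrite IA in tA; rewrite IB in tB; rewrite IC in tC.
assert (EA : u * Rabs (area2 A B C) = r * a)
  by (apply sqr_scaled_abs; nra).
assert (EB : v * Rabs (area2 A B C) = r * b)
  by (apply sqr_scaled_abs; nra).
assert (EC : (1 - u - v) * Rabs (area2 A B C) = r * c)
  by (apply sqr_scaled_abs; nra).
lra.
Qed.

Lemma strict_triangle (A B C : point) (a b c : R) :
  nondegenerate A B C ->
  a = pdist B C -> b = pdist C A -> c = pdist A B ->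
  0 < b + c - a /\ 0 < c + a - b /\ 0 < a + b - c.
Proof.
intros Hnd ha hb hc.
pose proof (nondegenerate_area2 A B C Hnd) as HW.
pose proof (heron A B C a b c ha hb hc) as HH.
assert (Ha : 0 <= a) by (rewrite ha; apply pdist_nonneg).
assert (Hb : 0 <= b) by (rewrite hb; apply pdist_nonneg).
assert (Hc : 0 <= c) by (rewrite hc; apply pdist_nonneg).
assert (HW2 : 0 < area2 A B C * area2 A B C) by nra.
assert (Hprod : 0 < (b + c - a) * (c + a - b) * (a + b - c)).
{ destruct (Rlt_le_dec 0 ((b + c - a) * (c + a - b) * (a + b - c)));
    [assumption|nra]. }
clear ha hb hc HH HW HW2 Hnd.
(* One nonpositive factor alone makes the product nonpositive. Two of them force their half-sum, a
   side, to be 0, and then both factors are 0. *)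
destruct (Rlt_le_dec 0 (b + c - a)), (Rlt_le_dec 0 (c + a - b)),
  (Rlt_le_dec 0 (a + b - c)); try (repeat split; assumption); exfalso;
  [ assert (0 < (b + c - a) * (c + a - b)) by nra
  | assert (0 < (b + c - a) * (a + b - c)) by nra
  | assert (a = 0) by lra
  | assert (0 < (c + a - b) * (a + b - c)) by nra
  | assert (b = 0) by lra
  | assert (c = 0) by lra
  | assert (a = 0) by lra ]; nra.
Qed.

(** With [S] the absolute value of [area2], one has [S = r * (a + b + c)] and
    [2 * Rc * S = a * b * c]; eliminating [S] through Heron's formula gives the ratio. *)
Lemma radius_ratio (A B C : point) (a b c Rc r : R) :
  nondegenerate A B C ->
  a = pdist B C -> b = pdist C A -> c = pdist A B ->
  is_circumradius A B C Rc -> is_inradius A B C r ->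
  2 * r / Rc = (b + c - a) * (c + a - b) * (a + b - c) / (a * b * c).
Proof.
intros Hnd ha hb hc hR hr.
destruct (strict_triangle A B C a b c Hnd ha hb hc) as [H1 [H2 H3]].
pose proof (heron A B C a b c ha hb hc) as HH.
pose proof (circumradius_sqr A B C a b c Rc ha hb hc hR) as HR.
pose proof (inradius_area2 A B C a b c r ha hb hc hr) as Hr.
assert (HRc : 0 <= Rc)
  by (destruct hR as [O [E _]]; rewrite <- E; apply pdist_nonneg).
set (S := Rabs (area2 A B C)) in *.
assert (HS : area2 A B C * area2 A B C = S * S)
  by (unfold S; rewrite <- Rabs_mult, Rabs_pos_eq; [reflexivity|nra]).
assert (HS0 : 0 <= S) by apply Rabs_pos.
rewrite HS in HH, HR; clearbody S.
assert (Habc : 0 < a * b * c) by (repeat apply Rmult_lt_0_compat; lra).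
assert (E : 2 * Rc * S = a * b * c).
{ apply Rsqr_inj; [nra|lra|unfold Rsqr; nra]. }
assert (HRc0 : Rc <> 0) by (intros ->; lra).
apply (Rmult_eq_reg_l (a + b + c)); [|lra].
replace ((a + b + c) * (2 * r / Rc)) with (2 * S / Rc)
  by (rewrite Hr; field; exact HRc0).
replace ((a + b + c) *
         ((b + c - a) * (c + a - b) * (a + b - c) / (a * b * c)))
  with ((a + b + c) * ((b + c - a) * (c + a - b) * (a + b - c)) / (a * b * c))
  by (field; repeat split; lra).
rewrite <- HH, <- E; field; split; [|exact HRc0].
intros ->; lra.
Qed.

(** * The inequalities and the equality cases *)

Lemma Rpower_base_1 (k : R) : Rpower 1 k = 1.
Proof. unfold Rpower; rewrite ln_1, Rmult_0_r; apply exp_0. Qed.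

Theorem theorem2p2 (A B C : point) (a b c Rc r k : R)
  (hABC : nondegenerate A B C)
  (ha : a = pdist B C) (hb : b = pdist C A) (hc : c = pdist A B)
  (hR : is_circumradius A B C Rc) (hr : is_inradius A B C r) :
  (k > 1 -> Lsum a b c k >= 2 + Rpower (2 * r / Rc) k) /\
  (k < 1 -> Lsum a b c k <= 2 + Rpower (2 * r / Rc) k) /\
  (k <> 0 -> k <> 1 ->
     (Lsum a b c k = 2 + Rpower (2 * r / Rc) k <-> isosceles A B C)) /\
  (k = 0 \/ k = 1 -> Lsum a b c k = 2 + Rpower (2 * r / Rc) k).
Proof.
rewrite (radius_ratio A B C a b c Rc r hABC ha hb hc hR hr).
destruct (strict_triangle A B C a b c hABC ha hb hc) as [H1 [H2 H3]].
unfold isosceles; rewrite <- ha, <- hb, <- hc.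
clear A B C hABC ha hb hc hR hr.
assert (Ha : 0 < a) by lra; assert (Hb : 0 < b) by lra;
  assert (Hc : 0 < c) by lra.
unfold Lsum.
set (x := a * (b + c - a) / (b * c)).
set (y := b * (c + a - b) / (c * a)).
set (z := c * (a + b - c) / (a * b)).
replace ((b + c - a) * (c + a - b) * (a + b - c) / (a * b * c))
  with (x * y * z) by (unfold x, y, z; field; lra).
assert (Hpos : forall s t, 0 < s -> 0 < t -> 0 < s / t)
  by (intros; apply Rdiv_lt_0_compat; assumption).
assert (Hx : 0 < x) by (apply Hpos; nra).
assert (Hy : 0 < y) by (apply Hpos; nra).
assert (Hz : 0 < z) by (apply Hpos; nra).
assert (Hsum : x + y + z = 2 + x * y * z) by (unfold x, y, z; field; lra).
assert (Hiso : c = a \/ a = b \/ b = c ->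
  Rpower x k + Rpower y k + Rpower z k = 2 + Rpower (x * y * z) k).
{ intros [E|[E|E]].
  - assert (x = 1) as -> by (unfold x; rewrite E; field; lra).
    assert (z = 1) as -> by (unfold z; rewrite E; field; lra).
    rewrite Rmult_1_l, Rmult_1_r, Rpower_base_1; ring.
  - assert (x = 1) as -> by (unfold x; rewrite E; field; lra).
    assert (y = 1) as -> by (unfold y; rewrite E; field; lra).
    rewrite !Rmult_1_l, Rpower_base_1; ring.
  - assert (y = 1) as -> by (unfold y; rewrite E; field; lra).
    assert (z = 1) as -> by (unfold z; rewrite E; field; lra).
    rewrite !Rmult_1_r, Rpower_base_1; ring. }
assert (H01 : k = 0 \/ k = 1 ->
  Rpower x k + Rpower y k + Rpower z k = 2 + Rpower (x * y * z) k).
{ assert (0 < x * y * z) by (apply Rmult_lt_0_compat; [nra|assumption]).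
  (* At exponent 0 both sides are 3; at exponent 1 the claim is [Hsum]. *)
  intros [->| ->]; [rewrite !Rpower_O|rewrite !Rpower_1]; try assumption; lra. }
assert (Hscal : ~ (c = a \/ a = b \/ b = c) ->
  (k > 1 -> Rpower x k + Rpower y k + Rpower z k > 2 + Rpower (x * y * z) k) /\
  (k < 1 -> k <> 0 ->
   Rpower x k + Rpower y k + Rpower z k < 2 + Rpower (x * y * z) k)).
{ intros Hn.
  assert (Lt1 : forall s d, s <> 0 -> d <> 0 -> 1 - (d / s) * (d / s) < 1).
  { intros s d Hs Hd.
    assert (d / s <> 0) by (apply Rmult_integral_contrapositive_currified;
      [assumption|apply Rinv_neq_0_compat; assumption]).
    nra. }
  apply Rpower_sum_signs; try assumption.
  - replace (x * y) with (1 - ((a - b) / c) * ((a - b) / c))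
      by (unfold x, y; field; lra); apply Lt1; lra.
  - replace (y * z) with (1 - ((b - c) / a) * ((b - c) / a))
      by (unfold y, z; field; lra); apply Lt1; lra.
  - replace (z * x) with (1 - ((c - a) / b) * ((c - a) / b))
      by (unfold z, x; field; lra); apply Lt1; lra. }
clearbody x y z.
(* If two sides agree, [Hiso] settles every claim at once; what remains is the scalene case with
   strict inequalities. *)
destruct (Req_dec c a) as [Eca|Eca];
  [specialize (Hiso (or_introl Eca)); intuition lra|].
destruct (Req_dec a b) as [Eab|Eab];
  [specialize (Hiso (or_intror (or_introl Eab))); intuition lra|].
destruct (Req_dec b c) as [Ebc|Ebc];
  [specialize (Hiso (or_intror (or_intror Ebc))); intuition lra|].
destruct Hscal as [Hgt Hlt]; [lra|].
split; [intros Hk; specialize (Hgt Hk); lra|].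
(* The strict bound excludes exponent 0, where equality holds instead. *)
split; [intros Hk; destruct (Req_dec k 0) as [K|K];
        [rewrite H01 by (left; exact K); lra|specialize (Hlt Hk K); lra]|].
split; [|exact H01].
intros K0 K1; split; [|lra].
intros E; exfalso.
destruct (Rtotal_order k 1) as [K|[K|K]];
  [specialize (Hlt K K0)|contradiction|specialize (Hgt K)]; lra.
Qed.
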